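(* Let $\Gamma=(X,R)$ be a bipartite distance-regular graph with even diameter $D\ge 4$ and valency $k\ge3$, let $d=D/2$, fix $x\in X$, and let $W$ be a thin irreducible $T(x)$-module with endpoint $2$ and local eigenvalue $\tilde\theta_d$; let $v$ be a nonzero vector in $E^*_2W$. Then the vectors $E_iv$ $(1\le i\le D-1,\ i\ne d)$ are mutually orthogonal, and $$\|E_iv\|^2=\frac{m_i(k-\theta_i)(k+\theta_i)\theta_i^2}{|X|\,k\,b_1b_2}\,\|v\|^2\qquad(1\le i\le D-1,\ i\ne d).$$
   Context: $\Gamma$ is a finite connected bipartite distance-regular graph with path-length distance $\partial$, intersection numbers $c_i,b_i$ ($c_0=0,b_D=0$). $A_i$ are the distance matrices, $A=A_1$; $\theta_0=k>\theta_1>\dots>\theta_D$ are the distinct eigenvalues of $A$, $E_i$ the primitive idempotent for $\theta_i$, and $m_i=\operatorname{rank}E_i$. $V=\mathbb{C}^X$ with Hermitian inner product $\langle u,w\rangle=u^t\bar w$ and $\|u\|^2=\langle u,u\rangle$. $E^*_i$ is the diagonal matrix with $(y,y)$-entry $1$ if $\partial(x,y)=i$ and $0$ otherwise; $T(x)$ is the algebra generated by $A,E^*_0,\dots,E^*_D$. A $T$-module is a subspace of $V$ invariant under $T$; irreducible means nonzero with no $T$-submodules other than $0$ and itself; thin means $\dim E^*_iW\le1$ for all $i$; endpoint is $\min\{i:E^*_iW\ne0\}$. For thin irreducible $W$ with endpoint $2$, $E^*_2W$ is a one-dimensional eigenspace of $E^*_2A_2E^*_2$, whose eigenvalue is the local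 eigenvalue of $W$. $\tilde\theta_d=-1-b_2b_3(\theta_d^2-b_2)^{-1}$. *)

(* Defs.v *)
From HB Require Import structures.
From mathcomp Require Import all_boot all_order all_algebra.

Set Implicit Arguments.
Unset Strict Implicit.
Unset Printing Implicit Defensive.

Import Order.TTheory GRing.Theory Num.Theory.

Local Open Scope ring_scope.

(* A graph is an edge relation [e : rel X] on a finite vertex set.  Matrices   *)
(* and vectors indexed by X are indexed by 'I_#|X| through [enum_val].         *)
(* The scalars are any numClosedFieldType C; the complex numbers are one.      *)

Definition simple_graph (X : finType) (e : rel X) : Prop :=
  symmetric e /\ irreflexive e.

Definition connected_graph (X : finType) (e : rel X) : Prop :=
  forall x y : X, connect e x y.

Definition bipartite (X : finType) (e : rel X) : Prop :=
  exists col : X -> bool, forall x y : X, e x y -> col x != col y.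

Definition has_walk (X : finType) (e : rel X) (x y : X) (n : nat) : bool :=
  [exists p : n.-tuple X, path e x p && (last x p == y)].

(* The least length of a walk from x to y; the search range suffices as soon   *)
(* as y is reachable from x (the value is #|X| otherwise).                     *)
Definition gdist (X : finType) (e : rel X) (x y : X) : nat :=
  find (has_walk e x y) (iota 0 #|X|).

Definition diameter (X : finType) (e : rel X) : nat :=
  (\max_(p : X * X) gdist e p.1 p.2)%N.

Definition regular_graph (X : finType) (e : rel X) (k : nat) : Prop :=
  forall x : X, #|[set y | e x y]| = k.

(* Only the values c_i, b_i with i at most the diameter are constrained.       *)
Definition distance_regular (X : finType) (e : rel X) (c b : nat -> nat) : Prop :=
  forall x y : X,
    #|[set z | e y z & (gdist e x z).+1 == gdist e x y]| = c (gdist e x y) /\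
    #|[set z | e y z & gdist e x z == (gdist e x y).+1]| = b (gdist e x y).

Definition distmx (C : numClosedFieldType) (X : finType) (e : rel X) (i : nat)
    : 'M[C]_#|X| :=
  \matrix_(p, q) (gdist e (enum_val p) (enum_val q) == i)%:R.

Definition adjmx (C : numClosedFieldType) (X : finType) (e : rel X)
    : 'M[C]_#|X| := distmx C e 1.

Definition ordered_eigenvalues (C : numClosedFieldType) (X : finType)
    (e : rel X) (k D : nat) (theta : nat -> C) : Prop :=
  [/\ theta 0%N = k%:R,
      forall i j : nat, (i < j <= D)%N -> theta j < theta i
    & forall a : C,
        eigenvalue (adjmx C e) a <-> exists2 i : nat, (i <= D)%N & theta i = a].

Definition bose_mesner (C : numClosedFieldType) (X : finType) (e : rel X)
    : {vspace 'M[C]_#|X|} :=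
  <<[seq distmx C e i | i <- iota 0 (diameter e).+1]>>%VS.

Definition primitive_idempotent (C : numClosedFieldType) (X : finType)
    (e : rel X) (E : 'M[C]_#|X|) : Prop :=
  [/\ E \in bose_mesner C e, E != 0, E *m E = E
    & forall F : 'M[C]_#|X|, F \in bose_mesner C e -> F *m F = F ->
        E *m F = F -> F *m E = F -> F = 0 \/ F = E].

Definition primitive_idempotent_for (C : numClosedFieldType) (X : finType)
    (e : rel X) (a : C) (E : 'M[C]_#|X|) : Prop :=
  primitive_idempotent e E /\ adjmx C e *m E = a *: E.

Definition herm (C : numClosedFieldType) (n : nat) (u w : 'cV[C]_n) : C :=
  (u^T *m map_mx Num.conj w) 0 0.

Definition normsq (C : numClosedFieldType) (n : nat) (u : 'cV[C]_n) : C :=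
  herm u u.

Definition dual_idempotent (C : numClosedFieldType) (X : finType) (e : rel X)
    (x : X) (i : nat) : 'M[C]_#|X| :=
  diag_mx (\row_p (gdist e x (enum_val p) == i)%:R).

Inductive terwilliger_algebra (C : numClosedFieldType) (X : finType)
    (e : rel X) (x : X) : 'M[C]_#|X| -> Prop :=
| TA_adj : terwilliger_algebra e x (adjmx C e)
| TA_dual (i : nat) : (i <= diameter e)%N ->
    terwilliger_algebra e x (dual_idempotent C e x i)
| TA_one : terwilliger_algebra e x 1%:M
| TA_add (M N : 'M[C]_#|X|) : terwilliger_algebra e x M ->
    terwilliger_algebra e x N -> terwilliger_algebra e x (M + N)
| TA_scale (a : C) (M : 'M[C]_#|X|) : terwilliger_algebra e x M ->
    terwilliger_algebra e x (a *: M)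
| TA_mul (M N : 'M[C]_#|X|) : terwilliger_algebra e x M ->
    terwilliger_algebra e x N -> terwilliger_algebra e x (M *m N).

Definition T_module (C : numClosedFieldType) (X : finType) (e : rel X) (x : X)
    (W : {vspace 'cV[C]_#|X|}) : Prop :=
  forall M : 'M[C]_#|X|, terwilliger_algebra e x M ->
  forall w : 'cV[C]_#|X|, w \in W -> M *m w \in W.

Definition irreducible_T_module (C : numClosedFieldType) (X : finType)
    (e : rel X) (x : X) (W : {vspace 'cV[C]_#|X|}) : Prop :=
  [/\ T_module e x W, W != 0%VS
    & forall U : {vspace 'cV[C]_#|X|},
        T_module e x U -> (U <= W)%VS -> U = 0%VS \/ U = W].

(* The subspace E*_i W. *)
Definition subconstituent (C : numClosedFieldType) (X : finType) (e : rel X)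
    (x : X) (i : nat) (W : {vspace 'cV[C]_#|X|}) : {vspace 'cV[C]_#|X|} :=
  (linfun (mulmx (dual_idempotent C e x i)) @: W)%VS.

Definition thin (C : numClosedFieldType) (X : finType) (e : rel X) (x : X)
    (W : {vspace 'cV[C]_#|X|}) : Prop :=
  forall i : nat, (i <= diameter e)%N -> (\dim (subconstituent e x i W) <= 1)%N.

(* The minimum of the i with E*_i W <> 0. *)
Definition endpoint (C : numClosedFieldType) (X : finType) (e : rel X) (x : X)
    (W : {vspace 'cV[C]_#|X|}) : nat :=
  find (fun i => subconstituent e x i W != 0%VS) (iota 0 (diameter e).+1).

(* Meant for W thin irreducible with endpoint 2: then E*_2 W has dimension 1,  *)
(* so that eta is unique.                                                      *)
Definition local_eigenvalue (C : numClosedFieldType) (X : finType) (e : rel X)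
    (x : X) (W : {vspace 'cV[C]_#|X|}) (eta : C) : Prop :=
  forall w : 'cV[C]_#|X|, w \in subconstituent e x 2 W ->
    dual_idempotent C e x 2 *m distmx C e 2 *m dual_idempotent C e x 2 *m w
    = eta *: w.

Definition theta_tilde (C : numClosedFieldType) (b : nat -> nat) (t : C) : C :=
  - 1 - (b 2%N)%:R * (b 3%N)%:R * (t ^+ 2 - (b 2%N)%:R)^-1.

(* Main.v *)
Require Import Defs.
From HB Require Import structures.
From mathcomp Require Import all_boot all_order all_algebra ring zify.

Set Implicit Arguments.
Unset Strict Implicit.
Unset Printing Implicit Defensive.

Import Order.TTheory GRing.Theory Num.Theory.

Local Open Scope ring_scope.

(* Write [E i] as the sum over h of [a h *: distmx C e h].  Comparing traces      *)
(* gives [#|X|%:R * a 0 = m_i], and [A *m E i = theta i *: E i] gives the         *)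
(* recurrence [theta i * a h = c h * a (h - 1) + b h * a (h + 1)].  Since v lives *)
(* on the sphere of radius 2 about x and the graph is bipartite, only a 0, a 2    *)
(* and a 4 enter [||E i v||^2 = <E i v, v>].  On that sphere A_4 = J - I - A_2,   *)
(* and J v = 0 because W has no component at x, so [E i] acts on v, up to the     *)
(* projection on the sphere, as the scalar [a 0 + a 2 * eta - a 4 * (1 + eta)].   *)
(* The spectrum is symmetric, hence theta d = 0 and eta = b 3 - 1, and for this   *)
(* value the scalar factors as stated.                                            *)

(** Orthogonality comes from [E i *m E j = 0]: the matrices are real symmetric, and inserting the
    adjacency matrix between them multiplies the product by [theta i] as well as by [theta j]. For
    the norms, [sum_eq0_of_endpoint] gives J v = 0, [second_subconstituent_eigen] the scalar,
    [middle_eq0] the vanishing of [theta d], and [cosine_combination] the factorization. The latter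
    is a telescoping: with t = [theta i] and eta = b 3 - 1 the scalar collapses to t (a 1 - a 3),
    then to t^2 (a 0 - a 2) / b 2, and a 0 - a 2 = a 0 (k^2 - t^2) / (k b 1). *)

Section Distance.

Variables (X : finType) (e : rel X).

Lemma has_walkP (x y : X) (n : nat) :
  reflect (exists2 p, path e x p & last x p = y /\ size p = n)
          (has_walk e x y n).
Proof.
apply: (iffP existsP) => [[p /andP[xp /eqP <-]]|[p xp [<- <-]]].
  by exists p => //; rewrite size_tuple.
by exists (in_tuple p); rewrite xp eqxx.
Qed.

Lemma gdist_le_size (x : X) (p : seq X) :
  path e x p -> (gdist e x (last x p) <= size p)%N.
Proof.
move=> xp; case: (ltnP (size p) #|X|) => [lt_pX|].
  rewrite leqNgt; apply/negP => /(before_find 0%N).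
  by rewrite nth_iota // add0n => /has_walkP[]; exists p.
(* A failed search returns [#|X|], so [gdist] never exceeds it. *)
by apply: leq_trans; rewrite /gdist -[leqRHS](size_iota 0) find_size.
Qed.

Lemma gdistxx (x : X) : gdist e x x = 0%N.
Proof. by apply/eqP; rewrite -leqn0 (@gdist_le_size x [::]). Qed.

Hypotheses (e_sym : symmetric e) (e_conn : connected_graph e).

(** A walk with repetitions removed has fewer than [#|X|] edges, so the search range of [gdist]
    contains its length and the search succeeds. *)
Lemma gdist_walk (x y : X) :
  exists2 p, path e x p & last x p = y /\ size p = gdist e x y.
Proof.
apply/has_walkP; have /connectP[p xp ->] := e_conn x y.
case/shortenP: xp => q xq uq _.
have lt_qX : (size q < #|X|)%N.
  by rewrite -ltnS -[X in (X < _)%N](card_uniqP uq) ltnS max_card.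
have hasq : has (has_walk e x (last x q)) (iota 0 #|X|).
  by apply/hasP; exists (size q); [rewrite mem_iota | apply/has_walkP; exists q].
have := nth_find 0%N hasq.
by rewrite nth_iota // -[ltnRHS](size_iota 0) -has_find.
Qed.

Lemma gdist_triangle (y x z : X) :
  (gdist e x z <= gdist e x y + gdist e y z)%N.
Proof.
have [p xp [lp <-]] := gdist_walk x y; have [q yq [lq <-]] := gdist_walk y z.
rewrite -size_cat -lq -[in last y q]lp -last_cat gdist_le_size //.
by rewrite cat_path xp lp.
Qed.

Lemma gdistC (x y : X) : gdist e x y = gdist e y x.
Proof.
suff le_xy u w : (gdist e u w <= gdist e w u)%N by apply/eqP; rewrite eqn_leq !le_xy.
have [p wp [lp <-]] := gdist_walk w u.
have : path e u (rev (belast w p)).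
  by rewrite -[u in path _ u]lp rev_path; apply: sub_path wp => s t; rewrite e_sym.
move/gdist_le_size; rewrite size_rev size_belast.
by case: p {wp} lp => [<-//|s p _] /=; rewrite rev_cons last_rcons.
Qed.

Lemma gdist_eq0 (x y : X) : (gdist e x y == 0%N) = (x == y).
Proof.
apply/eqP/eqP => [|->]; last exact: gdistxx.
by have [[|s p] _ [<- <-]] := gdist_walk x y.
Qed.

Lemma gdist_pred (x y : X) (n : nat) :
  gdist e x y = n.+1 -> exists2 z, e y z & gdist e x z = n.
Proof.
have [p + [<-]] := gdist_walk x y.
case/lastP: p => [|p s]; rewrite ?gdistxx // rcons_path last_rcons size_rcons.
move=> /andP[xp lps] sp xs; exists (last x p); first by rewrite e_sym.
have {}sp : size p = n by apply/succn_inj; rewrite sp xs.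
apply/eqP; rewrite eqn_leq -{1}sp gdist_le_size //= -ltnS -xs -addn1.
apply: leq_trans (gdist_triangle (last x p) x s) _; rewrite leq_add2l.
by apply: (@gdist_le_size _ [:: s]); rewrite /= lps.
Qed.

Lemma gdist_intermediate (x y : X) (m : nat) :
  (m <= gdist e x y)%N -> exists z, gdist e x z = m.
Proof.
move: {2}(gdist e x y) (erefl (gdist e x y)) => n; elim: n y => [|n IHn] y xy.
  by rewrite xy leqn0 => /eqP ->; exists y.
rewrite xy leq_eqVlt => /predU1P[->|]; first by exists y.
by have [z _ xz] := gdist_pred xy; rewrite ltnS -xz => /IHn; apply.
Qed.

Hypothesis e_irr : irreflexive e.

Lemma gdist_eq1 (x y : X) : (gdist e x y == 1%N) = e x y.
Proof.
apply/eqP/idP => [/gdist_pred[z + /eqP]|xy].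
  by rewrite gdist_eq0 e_sym => + /eqP ->.
apply/eqP; rewrite eqn_leq lt0n gdist_eq0.
rewrite (@gdist_le_size _ [:: y]) /= ?xy //.
by apply: contraTneq xy => ->; rewrite e_irr.
Qed.

Lemma gdist_le_diameter (x y : X) : (gdist e x y <= diameter e)%N.
Proof. exact: (bigop.leq_bigmax (x, y)). Qed.

Lemma gdist_attained (x0 : X) (h : nat) :
  (h <= diameter e)%N -> exists x y, gdist e x y = h.
Proof.
rewrite /diameter; have [|[x y] ->] := @bigop.eq_bigmax _ (fun p : X * X => gdist e p.1 p.2).
  by apply/card_gt0P; exists (x0, x0).
by move=> /gdist_intermediate[z]; exists x, z.
Qed.

(** * Parity of distances, and intersection numbers *)

Section Bipartite.

Variable col : X -> bool.
Hypothesis col_proper : forall x y, e x y -> col x != col y.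

Lemma odd_gdist (x y : X) : odd (gdist e x y) = col x (+) col y.
Proof.
have [p + [<- <-]] := gdist_walk x y.
elim: p x => [|s p IHp] x /=; first by rewrite addbb.
move=> /andP[/col_proper + /IHp->].
by case: (col x); case: (col s); case: (col _).
Qed.

Lemma gdist_edge (x y z : X) :
  e y z -> (gdist e x z).+1 = gdist e x y \/ gdist e x z = (gdist e x y).+1.
Proof.
move=> yz; have yz1 : gdist e y z = 1%N by apply/eqP; rewrite gdist_eq1.
have := gdist_triangle y x z; have := gdist_triangle z x y.
rewrite (gdistC z) yz1.
have : odd (gdist e x y) != odd (gdist e x z).
  by rewrite !odd_gdist; have := col_proper yz; case: (col x) (col y) (col z) => -[] [].
lia.
Qed.

Variables (c b : nat -> nat) (k : nat).
Hypotheses (drg : distance_regular e c b) (reg : regular_graph e k).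

(** By parity no edge joins two vertices at the same distance from [x], so the neighbours of [y] are
    either nearer or farther. All later uses of distance-regularity for sums over neighbours go
    through this identity, with values in [nat] or in [C]. *)
Lemma sum_neighbours (V : nmodType) (F : nat -> V) (x y : X) :
  \sum_(z | e y z) F (gdist e x z) =
  F (gdist e x y).-1 *+ c (gdist e x y) + F (gdist e x y).+1 *+ b (gdist e x y).
Proof.
have [<- <-] := drg x y.
rewrite (bigID (fun z => (gdist e x z).+1 == gdist e x y)) /= -!sumr_const.
congr (_ + _).
  rewrite [RHS](eq_bigl (fun z => e y z && ((gdist e x z).+1 == gdist e x y))).
    by apply: eq_bigr => z /andP[_ /eqP <-].
  by move=> z; rewrite inE.
rewrite [RHS](eq_bigl (fun z => e y z && (gdist e x z == (gdist e x y).+1))).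
  rewrite (eq_bigl (fun z => e y z && (gdist e x z == (gdist e x y).+1))).
    by apply: eq_bigr => z /andP[_ /eqP <-].
  by move=> z; case: (boolP (e y z)) => // /(gdist_edge x) /=; lia.
by move=> z; rewrite inE.
Qed.

Lemma intersection_c0 (x0 : X) : c 0%N = 0%N.
Proof.
have [+ _] := drg x0 x0; rewrite gdistxx => <-.
by apply/eqP; rewrite cards_eq0; apply/eqP/setP => z; rewrite !inE andbF.
Qed.

Lemma intersection_c_gt0 (x0 : X) (h : nat) :
  (0 < h <= diameter e)%N -> (0 < c h)%N.
Proof.
case: h => // h /(gdist_attained x0)[x [y xy]].
have [+ _] := drg x y; rewrite xy => <-; rewrite card_gt0; apply/set0Pn.
by have [z yz xz] := gdist_pred xy; exists z; rewrite inE yz xz /=.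
Qed.

Lemma intersection_b_gt0 (x0 : X) (h : nat) : (h < diameter e)%N -> (0 < b h)%N.
Proof.
move=> /(gdist_attained x0)[x [y xy]]; have [z yz xz] := gdist_pred xy.
have [_ +] := drg x z; rewrite xz => <-; rewrite card_gt0; apply/set0Pn.
by exists y; rewrite inE e_sym yz xy /=.
Qed.

Lemma intersection_c1 (x0 : X) : (0 < diameter e)%N -> c 1%N = 1%N.
Proof.
move=> /(gdist_attained x0)[x [y xy]].
have [+ _] := drg x y; rewrite xy => <-; apply/eqP/cards1P; exists x.
apply/setP => z; rewrite !inE eqSS gdist_eq0 [x == z]eq_sym.
case: eqP => [->|_]; last by rewrite andbF.
by rewrite e_sym -gdist_eq1 xy.
Qed.

Lemma intersection_cDb (x0 : X) (h : nat) :
  (h <= diameter e)%N -> (c h + b h = k)%N.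
Proof.
move=> /(gdist_attained x0)[x [y <-]].
have := @sum_neighbours nat (fun=> 1%N) x y; rewrite !natn => /esym; rewrite natrDE => ->.
by rewrite -(reg y) -sum1dep_card.
Qed.

(** * The adjacency matrix and the eigenmatrices in the Bose-Mesner algebra *)

Variable C : numClosedFieldType.

Lemma adjmxE (p q : 'I_#|X|) :
  adjmx C e p q = (e (enum_val p) (enum_val q))%:R.
Proof. by rewrite mxE gdist_eq1. Qed.

Lemma mul_adjmxE (n : nat) (M : 'M[C]_(#|X|, n)) (y : X) (j : 'I_n) :
  (adjmx C e *m M) (enum_rank y) j = \sum_(z | e y z) M (enum_rank z) j.
Proof.
rewrite mxE [RHS]big_mkcond [RHS](reindex (@enum_val X X)) /=; last first.
  exact/onW_bij/enum_val_bij.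
apply: eq_bigr => p _; rewrite adjmxE enum_rankK enum_valK.
by case: (e _ _); rewrite (mul1r, mul0r).
Qed.

Lemma adjmx_sym : (adjmx C e)^T = adjmx C e.
Proof. by apply/matrixP => p q; rewrite mxE !adjmxE e_sym. Qed.

(** Changing the sign of an eigenvector on one colour class negates its eigenvalue. *)
Lemma eigenvalue_adjmxN (a : C) :
  eigenvalue (adjmx C e) a -> eigenvalue (adjmx C e) (- a).
Proof.
case/eigenvalueP => u /rowP uA u0; pose s y : C := (-1) ^+ col y.
apply/eigenvalueP; exists (\row_p (s (enum_val p) * u 0 p)).
  apply/rowP => q; have := uA q; rewrite !mxE => uAq.
  rewrite mulNr mulrCA -uAq mulr_sumr -sumrN; apply: eq_bigr => p _.
  rewrite mxE adjmxE; case: (boolP (e _ _)) => [/col_proper pq|_].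
    rewrite !mulr1 /s; case: (col _) (col _) pq => -[] // _;
    by rewrite ?expr0 ?expr1 !(mulN1r, mul1r, opprK).
  by rewrite !mulr0 oppr0.
apply: contraNneq u0 => /rowP u0; apply/eqP/rowP => p; apply/eqP.
by have /eqP := u0 p; rewrite !mxE mulf_eq0 signr_eq0.
Qed.

Lemma bose_mesner_gdist (M : 'M[C]_#|X|) :
  M \in bose_mesner C e ->
  exists a, forall p q, M p q = a (gdist e (enum_val p) (enum_val q)).
Proof.
pose S := in_tuple [seq distmx C e i | i <- iota 0 (diameter e).+1].
move=> /(@coord_span _ _ _ S) eqM.
exists (fun h : nat => \sum_i coord S i M * (h == i :> nat)%:R) => p q; rewrite {1}eqM.
rewrite summxE; apply: eq_bigr => i _; rewrite mxE; congr (_ * _).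
have := ltn_ord i; rewrite [X in (_ < X)%N -> _]size_map size_iota => ltiD.
by rewrite (nth_map 0%N) ?size_iota // nth_iota // mxE.
Qed.

Section Eigenmatrix.

Variables (E : 'M[C]_#|X|) (a : nat -> C) (t : C).
Hypotheses (Ea : forall p q, E p q = a (gdist e (enum_val p) (enum_val q)))
           (AE : adjmx C e *m E = t *: E).

Lemma gdist_fun_sym : E^T = E.
Proof. by apply/matrixP => p q; rewrite mxE !Ea gdistC. Qed.

Lemma eigenmatrix_rec (x0 : X) (h : nat) :
  (h <= diameter e)%N -> t * a h = a h.-1 *+ c h + a h.+1 *+ b h.
Proof.
move=> /(gdist_attained x0)[x [y <-]].
rewrite -sum_neighbours gdistC.
have /matrixP/(_ (enum_rank y) (enum_rank x)) := AE.
rewrite mul_adjmxE [RHS]mxE Ea !enum_rankK => <-.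
by apply: eq_bigr => z _; rewrite Ea !enum_rankK gdistC.
Qed.

(** Since [b h] is nonzero below the diameter, the recurrence computes every [a h] from [a 0] by
    real operations. *)
Lemma eigenmatrix_real (x0 : X) :
  t \is Num.real -> a 0%N \is Num.real -> map_mx Num.conj E = E.
Proof.
move=> t_real a0_real.
have a_real h : (h <= diameter e)%N -> a h \is Num.real.
  elim/ltn_ind: h => -[//|h] IHh ltD.
  have b0 : (b h)%:R != 0 :> C by rewrite pnatr_eq0 -lt0n (intersection_b_gt0 x0).
  have -> : a h.+1 = (t * a h - a h.-1 *+ c h) / (b h)%:R.
    by rewrite (eigenmatrix_rec x0 (ltnW ltD)) addrC addKr -[_ *+ b h]mulr_natr mulfK.
  have rh : a h \is Num.real by apply: IHh => //; apply: ltnW.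
  have rh1 : a h.-1 \is Num.real by apply: IHh; lia.
  by rewrite rpred_div ?realn // rpredB ?rpredM // rpredMn.
apply/matrixP => p q; rewrite mxE Ea; apply/conj_Creal/a_real.
exact: gdist_le_diameter.
Qed.

End Eigenmatrix.

(** * Vectors supported on the sphere of radius 2 *)

Section SecondSubconstituent.

Variables (x : X) (v : 'cV[C]_#|X|).
Let E2 := dual_idempotent C e x 2.
Hypothesis v_supp : E2 *m v = v.

Lemma supp2 (p : 'I_#|X|) : v p 0 != 0 -> gdist e x (enum_val p) = 2%N.
Proof.
rewrite -v_supp mul_diag_mx !mxE; apply: contraNeq => /negPf ->.
by rewrite mul0r.
Qed.

(** Each vertex at distance 2 from [x] is reached by [c 2] walks of length 2, so the entry of A^2 v
    at [x] is [c 2] times the sum of the entries of [v]. *)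
Lemma sum_eq0_of_endpoint :
  (1 < diameter e)%N ->
  dual_idempotent C e x 0 *m (adjmx C e *m (adjmx C e *m v)) = 0 ->
  \sum_p v p 0 = 0.
Proof.
move=> D1; rewrite [adjmx C e *m _]mulmxA => /colP/(_ (enum_rank x)).
rewrite mul_diag_mx [LHS]mxE [X in X * _]mxE [RHS]mxE enum_rankK gdistxx eqxx.
rewrite mul1r mxE.
have c2 : (c 2)%:R != 0 :> C by rewrite pnatr_eq0 -lt0n (intersection_c_gt0 x).
move=> s0; apply: (mulfI c2); rewrite mulr0 mulr_sumr -[RHS]s0.
apply: eq_bigr => p _; have [-> | /supp2 xp] := eqVneq (v p 0) 0; first by rewrite !mulr0.
congr (_ * _); rewrite mul_adjmxE.
under eq_bigr => z _ do rewrite adjmxE enum_rankK e_sym -gdist_eq1.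
(* Seen from [enum_val p], the neighbours of [x] lie at distance 1 or 3; the indicator of distance 1
   keeps the former. *)
by rewrite (sum_neighbours (fun h => (h == 1)%N%:R)) gdistC xp /= mul0rn addr0.
Qed.

Lemma second_subconstituent_eigen (E : 'M[C]_#|X|) (a : nat -> C) (eta : C) :
    (forall p q, E p q = a (gdist e (enum_val p) (enum_val q))) ->
    \sum_p v p 0 = 0 -> E2 *m distmx C e 2 *m E2 *m v = eta *: v ->
  E2 *m (E *m v) = (a 0%N + a 2%N * eta - a 4%N * (1 + eta)) *: v.
Proof.
move=> Ea sv0 v_eta.
(* By parity and the triangle inequality, two points of the sphere are at distance 0, 2 or 4, so [K]
   agrees with [E] there. *)
pose K := a 0%N *: 1%:M + a 2%N *: distmx C e 2
  + a 4%N *: (const_mx 1 - 1%:M - distmx C e 2).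
have -> : E2 *m (E *m v) = E2 *m (K *m v).
  apply/colP => p; rewrite !mul_diag_mx !mxE.
  have [xp|] := eqVneq (gdist e x (enum_val p)) 2%N; last by rewrite !mul0r.
  congr (_ * _); apply: eq_bigr => q _.
  have [-> | /supp2 xq] := eqVneq (v q 0) 0; first by rewrite !mulr0.
  congr (_ * _); rewrite Ea !mxE.
  have := gdist_triangle x (enum_val p) (enum_val q).
  have : odd (gdist e (enum_val p) (enum_val q)) = false.
    have := odd_gdist x (enum_val p); have := odd_gdist x (enum_val q).
    by rewrite xp xq odd_gdist; do 3!case: (col _).
  rewrite [gdist e _ x]gdistC xp xq -[p == q](inj_eq enum_val_inj) -gdist_eq0.
  by case: (gdist _ _ _) => [|[|[|[|[|]]]]] //= _ _;
  rewrite ?(mulr0, mulr1, subr0, addr0, add0r, subrr).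
have Jv : const_mx 1 *m v = 0 :> 'cV_#|X|.
  apply/colP => p; rewrite !mxE -[RHS]sv0; apply: eq_bigr => q _.
  by rewrite mxE mul1r.
have A2v : E2 *m (distmx C e 2 *m v) = eta *: v.
  by rewrite -v_eta -[in RHS]mulmxA v_supp mulmxA.
rewrite /K !mulmxDl !mulmxDr -!scalemxAl !mulmxBl -!scalemxAr !mulmxBr.
rewrite Jv mulmx0 mul1mx v_supp A2v.
by apply/colP => p; rewrite !mxE; ring.
Qed.

End SecondSubconstituent.

End Bipartite.

End Distance.

(** * Traces, symmetric spectra and the cosine recurrence *)

(** In the full-rank factorization of [M], idempotence forces the product of the factors in reverse
    order to be the identity of size [\rank M]; this product has the same trace. *)
Lemma mxtrace_idempotent (F : fieldType) (n : nat) (M : 'M[F]_n) :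
  M *m M = M -> \tr M = (\rank M)%:R.
Proof.
move=> MM; suff RC : row_base M *m col_base M = 1%:M.
  by rewrite -{1}[M]mulmx_base mxtrace_mulC RC mxtrace1.
apply: (row_free_inj (row_base_free M)); apply: (@row_full_inj _ _ _ _ (col_base M)) => //.
  exact: col_base_full.
by rewrite mul1mx -[X in _ *m X]mulmxA mulmx_base mulmxA mulmx_base.
Qed.

(** Negation reverses the order of the values, so it must send index i to D - i. The bounds [upper]
    and [lower] prove the two inequalities, and the middle index is fixed. *)
Lemma middle_eq0 (R : numDomainType) (D : nat) (theta : nat -> R) :
    ~~ odd D -> (forall i j, (i < j <= D)%N -> theta j < theta i) ->
    (forall i, (i <= D)%N -> exists2 j, (j <= D)%N & theta j = - theta i) ->
  theta D./2 = 0.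
Proof.
move=> D_even decr sym.
have decrN i j : (i <= D)%N -> theta j < theta i -> (i < j)%N.
  move=> iD ltji; rewrite ltnNge leq_eqVlt; apply/negP => /predU1P[ji | ltij].
    by rewrite ji ltxx in ltji.
  by have := lt_trans ltji (decr j i _); rewrite ltij iD ltxx => /(_ isT).
have upper i j : (i <= D)%N -> (j <= D)%N -> theta j = - theta i -> (j <= D - i)%N.
  elim: i j => [|i IHi] j iD jD ji; first by rewrite subn0.
  have [j' j'D j'i] := sym i (ltnW iD).
  have := IHi j' (ltnW iD) j'D j'i; suff: (j < j')%N by lia.
  by apply: decrN; rewrite // ji j'i ltrN2 decr // ltnSn.
have lower m j : (m <= D)%N -> (j <= D)%N -> theta j = - theta (D - m)%N -> (m <= j)%N.
  elim: m j => // m IHm j mD jD jm.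
  have [j' j'D j'm] := sym (D - m)%N (leq_subr _ _).
  have := IHm j' (ltnW mD) j'D j'm; suff: (j' < j)%N by lia.
  by apply: decrN; rewrite // jm j'm ltrN2 decr //; lia.
have [|j jD jd] := sym D./2; first by lia.
have := upper _ _ _ jD jd; have := lower D./2 j _ jD.
have -> : (D - D./2 = D./2)%N by lia.
move=> /(_ _ jd) lo up; have ej : j = D./2 by apply/eqP; rewrite eqn_leq lo ?up //; lia.
by apply/eqP; rewrite -[_ == _](mulrn_eq0 _ 2) mulr2n -{1}ej jd addNr.
Qed.

Lemma herm_adjoint (C : numClosedFieldType) (n : nat) (M : 'M[C]_n)
    (u w : 'cV[C]_n) :
  M^T = M -> map_mx Num.conj M = M -> herm (M *m u) w = herm u (M *m w).
Proof. by move=> MT MC; rewrite /herm map_mxM MC trmx_mul MT mulmxA. Qed.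

(* The hypotheses are the three-term recurrence of a cosine sequence, with     *)
(* [c0 = 0], [b0 = k], [c1 = 1] and [ci + bi = k] substituted.                 *)
Lemma cosine_combination (F : fieldType) (t k b1 b2 b3 c2 c3 a0 a1 a2 a3 a4 : F) :
    k != 0 -> b1 != 0 -> b2 != 0 ->
    1 + b1 = k -> c2 + b2 = k -> c3 + b3 = k ->
    t * a0 = a1 * k -> t * a1 = a0 + a2 * b1 ->
    t * a2 = a1 * c2 + a3 * b2 -> t * a3 = a2 * c3 + a4 * b3 ->
  a0 + a2 * (b3 - 1) - a4 * b3
    = a0 * ((k - t) * (k + t) * t ^+ 2) / (k * b1 * b2).
Proof.
move=> k0 b10 b20 k1 k2 k3 r0 r1 r2 r3.
have a1E : a1 = t * a0 / k by rewrite r0 mulfK.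
have a2E : a2 = (t * a1 - a0) / b1 by rewrite r1 addrC addKr mulfK.
have a3E : a3 = (t * a2 - a1 * c2) / b2 by rewrite r2 addrC addKr mulfK.
(* Only the product [a4 * b3] occurs, and the recurrence gives it without a division; with
   [c3 = k - b3] all terms in [b3] then cancel. *)
have -> : a4 * b3 = t * a3 - a2 * c3 by rewrite r3 addrC addKr.
have -> : c3 = k - b3 by rewrite -k3 addrK.
rewrite a3E a2E a1E.
have -> : c2 = k - b2 by rewrite -k2 addrK.
rewrite -k1 in k0 *.
by field; rewrite k0 b10 b20.
Qed.

(** * Orthogonality and the norm formula *)

Theorem theorem14p2 (C : numClosedFieldType) (X : finType) (e : rel X)
  (c b : nat -> nat) (k D d : nat) (theta : nat -> C)
  (E : nat -> 'M[C]_#|X|) (x : X) (W : {vspace 'cV[C]_#|X|})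
  (v : 'cV[C]_#|X|)
  (hG : simple_graph e) (hconn : connected_graph e) (hbip : bipartite e)
  (hdr : distance_regular e c b)
  (hD : D = diameter e) (hDeven : ~~ odd D) (hD4 : (4 <= D)%N) (hd : d = D./2)
  (hk : regular_graph e k) (hk3 : (3 <= k)%N)
  (htheta : ordered_eigenvalues e k D theta)
  (hE : forall i : nat, (i <= D)%N ->
        primitive_idempotent_for e (theta i) (E i))
  (hW : irreducible_T_module e x W) (hthin : thin e x W)
  (hend : endpoint e x W = 2%N)
  (hloc : local_eigenvalue e x W (theta_tilde b (theta d)))
  (hv : v \in subconstituent e x 2 W) (hv0 : v != 0) :
  (forall i j : nat, (1 <= i <= D - 1)%N -> i <> d ->
     (1 <= j <= D - 1)%N -> j <> d -> i <> j ->
     herm (E i *m v) (E j *m v) = 0) /\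
  (forall i : nat, (1 <= i <= D - 1)%N -> i <> d ->
     normsq (E i *m v) =
       (\rank (E i))%:R * (k%:R - theta i) * (k%:R + theta i) * theta i ^+ 2
       / (#|X|%:R * k%:R * (b 1%N)%:R * (b 2%N)%:R) * normsq v).
Proof.
have [e_sym e_irr] := hG; have [col hcol] := hbip.
have [th0 th_decr th_eig] := htheta.
have [Wmod _ _] := hW.
have cD := intersection_cDb e_sym hconn e_irr hcol hdr hk x.
have b_gt0 := intersection_b_gt0 e_sym hconn hdr x.
(* The recurrence at indices up to 3 reaches [a 4]; [4 <= D] keeps these indices below the
   diameter. *)
have cb (h : nat) : (h <= 3)%N -> (c h)%:R + (b h)%:R = k%:R :> C.
  by move=> h3; rewrite -natrD cD // -hD; lia.
have b_neq0 (h : nat) : (h <= 3)%N -> (b h)%:R != 0 :> C.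
  by move=> h3; rewrite pnatr_eq0 -lt0n b_gt0 // -hD; lia.
have c0 : c 0%N = 0%N := intersection_c0 hdr x.
have c1 : c 1%N = 1%N by apply: (intersection_c1 e_sym hconn e_irr hdr x); lia.
have th_inj i j : (i <= D)%N -> (j <= D)%N -> theta i = theta j -> i = j.
  move=> iD jD ij; case: (ltngtP i j) => // [lij|lji].
    by have := th_decr i j; rewrite lij jD ij ltxx => /(_ isT).
  by have := th_decr j i; rewrite lji iD ij ltxx => /(_ isT).
have th_real i : (i <= D)%N -> theta i \is Num.real.
  case: i => [|i] iD; first by rewrite th0 realn.
  (* An element comparable with the real number k is real. *)
  by rewrite (@ler_real _ (theta 0%N)) ?th0 ?realn // -th0 ltW ?th_decr.
have thd0 : theta d = 0.
  rewrite hd; apply: middle_eq0 hDeven th_decr _ => i iD.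
  apply/th_eig/(eigenvalue_adjmxN e_sym hconn e_irr hcol)/th_eig.
  by exists i.
have eta_eq : theta_tilde b (theta d) = (b 3%N)%:R - 1.
  rewrite /theta_tilde thd0 expr0n /= sub0r invrN mulrN opprK mulrAC.
  by rewrite divff ?b_neq0 // mul1r addrC.
have [u uW vE] : exists2 u, u \in W & v = dual_idempotent C e x 2 *m u.
  by have /memv_imgP[u uW ->] := hv; exists u; rewrite ?lfunE.
have E2K : dual_idempotent C e x 2 *m dual_idempotent C e x 2 =
    dual_idempotent C e x 2.
  rewrite mulmx_diag; congr diag_mx; apply/rowP => p; rewrite !mxE.
  by case: (_ == _); rewrite (mul0r, mul1r).
have v_supp : dual_idempotent C e x 2 *m v = v by rewrite vE mulmxA E2K.
have vW : v \in W by rewrite vE; apply: Wmod => //; apply: TA_dual; lia.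
(* The search defining [endpoint] stops at 2, hence it rejected index 0. *)
have W0 w : w \in W -> dual_idempotent C e x 0 *m w = 0.
  move=> wW; have /(before_find 0%N) : (0 < endpoint e x W)%N by rewrite hend.
  rewrite nth_iota // => /negbFE/eqP sub0.
  apply/eqP; rewrite -memv0 -sub0; apply/memv_imgP; exists w => //.
  by rewrite lfunE.
have sv0 : \sum_p v p 0 = 0.
  apply: (sum_eq0_of_endpoint e_sym hconn e_irr hcol hdr v_supp); first by lia.
  by apply/W0/Wmod; [exact: TA_adj | apply/Wmod => //; exact: TA_adj].
have E_props i : (i <= D)%N ->
    exists a, [/\ forall p q, E i p q = a (gdist e (enum_val p) (enum_val q)),
                  #|X|%:R * a 0%N = (\rank (E i))%:R,
                  (E i)^T = E i & map_mx Num.conj (E i) = E i].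
  move=> iD; have [[/bose_mesner_gdist[a Ea] _ EE _] AE] := hE i iD.
  have tr : #|X|%:R * a 0%N = (\rank (E i))%:R.
    rewrite -(mxtrace_idempotent EE) /mxtrace.
    under eq_bigr => p _ do rewrite Ea gdistxx.
    by rewrite sumr_const card_ord mulr_natl.
  exists a; split=> //; first exact: (gdist_fun_sym e_sym hconn Ea).
  apply: (eigenmatrix_real e_sym hconn e_irr hcol hdr Ea AE x); first exact: th_real.
  have X0 : #|X|%:R != 0 :> C by rewrite pnatr_eq0 -lt0n; apply/card_gt0P; exists x.
  by rewrite -[a 0%N](mulKf X0) tr rpredM // ?rpredV ?realn.
split=> [i j iD _ jD _ ij | i iD _].
  have iD' : (i <= D)%N by lia.
  have jD' : (j <= D)%N by lia.
  have [ai [_ _ Ei_sym Ei_real]] := E_props i iD'.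
  have [aj [_ _ Ej_sym _]] := E_props j jD'.
  have [_ AEi] := hE i iD'; have [_ AEj] := hE j jD'.
  suff E0 : E i *m E j = 0.
    by rewrite herm_adjoint // mulmxA E0 mul0mx /herm map_mx0 mulmx0 mxE.
  have EiA : E i *m adjmx C e = theta i *: E i.
    apply: trmx_inj; rewrite trmx_mul linearZ /= Ei_sym.
    by rewrite (adjmx_sym e_sym hconn e_irr).
  have : theta i *: (E i *m E j) = theta j *: (E i *m E j).
    by rewrite scalemxAl -EiA -mulmxA AEj scalemxAr.
  move/eqP; rewrite -subr_eq0 -scalerBl scaler_eq0 subr_eq0 => /orP[|/eqP//].
  by move=> /eqP/th_inj => /(_ iD' jD').
have iD' : (i <= D)%N by lia.
have [a [Ea tr Ei_sym Ei_real]] := E_props i iD'.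
have [[_ _ EE _] AE] := hE i iD'.
have E2_sym : (dual_idempotent C e x 2)^T = dual_idempotent C e x 2.
  exact: tr_diag_mx.
have E2_real : map_mx Num.conj (dual_idempotent C e x 2) =
    dual_idempotent C e x 2.
  rewrite map_diag_mx; congr diag_mx; apply/rowP => p; rewrite !mxE.
  exact: conj_Creal (realn _ _).
have v_eta := hloc v hv.
have E2Ev := second_subconstituent_eigen e_sym hconn hcol v_supp Ea sv0 v_eta.
(* As [E i] is a self-adjoint idempotent, the norm is the inner product of [E i *m v] with [v]; as
   [v] lives on the sphere, the first argument may be projected to it. *)
have -> : normsq (E i *m v) = herm (dual_idempotent C e x 2 *m (E i *m v)) v.
  by rewrite (herm_adjoint _ _ E2_sym E2_real) v_supp /normsq -herm_adjoint // mulmxA EE.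
rewrite E2Ev eta_eq {1}/herm linearZ /= -scalemxAl mxE -/(herm v v) -/(normsq v).
congr (_ * _); have -> : 1 + ((b 3%N)%:R - 1) = (b 3%N)%:R :> C by rewrite addrC subrK.
have rec := eigenmatrix_rec e_sym hconn e_irr hcol hdr Ea AE x.
have {}rec h : (h <= 3)%N ->
    theta i * a h = a h.-1 * (c h)%:R + a h.+1 * (b h)%:R.
  by move=> h3; rewrite rec ?mulr_natr // -hD; lia.
have b0 : (b 0%N)%:R = k%:R :> C by rewrite -(cb 0%N) // c0 add0r.
have k_neq0 : k%:R != 0 :> C by rewrite -b0 b_neq0.
rewrite (cosine_combination (t := theta i) (k := k%:R) (b1 := (b 1%N)%:R)
  (b2 := (b 2%N)%:R) (c2 := (c 2%N)%:R) (c3 := (c 3%N)%:R)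
  (a1 := a 1%N) (a3 := a 3%N)) ?b_neq0 ?cb ?rec //; last 3 first.
- by rewrite -(cb 1%N) // c1.
- by rewrite c0 mulr0 add0r b0.
- by rewrite c1 mulr1.
have X0 : #|X|%:R != 0 :> C by rewrite pnatr_eq0 -lt0n; apply/card_gt0P; exists x.
rewrite -tr; field.
by rewrite X0 k_neq0 !b_neq0.
Qed.
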